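(* Let $\mathbb{k}$ be a field with $\mathrm{char}(\mathbb{k})\neq 2$ and let $\Lambda$ be the path algebra over $\mathbb{k}$ of the quiver with vertices $1,2,3$ and arrows $\alpha\colon 1\to 2$, $\beta\colon 2\to 3$, $\gamma\colon 1\to 3$, modulo the ideal generated by $\beta\alpha$ (the path ''first $\alpha$, then $\beta$''). Then the functor $\Sigma$ is not naturally isomorphic to the identity functor on the orbit category $\mathsf{D^b}(\mathsf{mod}\,\Lambda)/\Sigma$, regarded as the full subcategory of gradable objects of $\mathsf K_1(\mathsf{proj}\,\Lambda)$.
   Context: Modules are right modules. $\mathsf{mod}\,\Lambda$ (resp. $\mathsf{proj}\,\Lambda$) is the category of finitely generated (resp. finitely generated projective) $\Lambda$-modules. $\mathsf K_1(\mathsf{proj}\,\Lambda)$ is the category whose objects are pairs $(P,\varepsilon_P)$ with $P\in\mathsf{proj}\,\Lambda$ and $\varepsilon_P\in\mathrm{End}_\Lambda(P)$, $\varepsilon_P^2=0$; morphisms $(P,\varepsilon_P)\to(Q,\varepsilon_Q)$ are the $\Lambda$-linear maps commuting with the differentials, modulo the maps of the form $s\varepsilon_P+\varepsilon_Qs$ with $s\colon P\to Q$ $\Lambda$-linear. It is triangulated with suspension functor $\Sigma$ given by $(P,\varepsilon_P)\mapsto(P,-\varepsilon_P)$ on objects and acting trivially on morphisms. An object of $\mathsf K_1(\mathsf{proj}\,\Lambda)$ is gradable if it is isomorphic to the compression $\Delta X=(\bigoplus_iX^i,\bigoplus_i\partial^i)$ of a bounded complex $(X,\partial)$ of finitely generated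 projective $\Lambda$-modules. The orbit category $\mathsf{D^b}(\mathsf{mod}\,\Lambda)/\Sigma$ (same objects as $\mathsf{D^b}(\mathsf{mod}\,\Lambda)$, morphisms $\bigoplus_{i\in\mathbb Z}\mathrm{Hom}(X,\Sigma^iY)$) is equivalent, via compression, to the full subcategory of gradable objects in $\mathsf K_1(\mathsf{proj}\,\Lambda)\cong\mathsf D_1(\mathsf{mod}\,\Lambda)$, and $\Sigma$ on it denotes the restriction of the suspension functor of $\mathsf K_1(\mathsf{proj}\,\Lambda)$. *)

(* Defs.v *)
From HB Require Import structures.
From mathcomp Require Import all_boot all_algebra.
From mathcomp Require Import boolp.
From mathcomp Require Import generic_quotient ring_quotient finmap monalg.

Set Implicit Arguments.
Unset Strict Implicit.
Unset Printing Implicit Defensive.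

Import GRing.Theory.
Local Open Scope ring_scope.
Local Open Scope quotient_scope.

Record quiver := Quiver {
  vert : finType;
  arr : finType;
  src : arr -> vert;
  tgt : arr -> vert }.

Section Paths.
Variable Q : quiver.

Fixpoint walk (x : vert Q) (s : seq (arr Q)) : bool :=
  if s is a :: s' then (src a == x) && walk (tgt a) s' else true.

Definition endpoint (x : vert Q) (s : seq (arr Q)) : vert Q :=
  last x (map (@tgt Q) s).

(* A path is its starting vertex together with its arrows, listed in the order
   in which they are travelled; [(x, [::])] is the trivial path at [x]. *)
Definition qpath := {p : vert Q * seq (arr Q) | walk p.1 p.2}.

Definition path_src (p : qpath) : vert Q := (val p).1.
Definition path_tgt (p : qpath) : vert Q := endpoint (val p).1 (val p).2.

Definition trivial_path (x : vert Q) : qpath :=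
  exist (fun p : vert Q * seq (arr Q) => walk p.1 p.2) (x, [::]) isT.

Lemma arrow_path_subproof (a : arr Q) : walk (src a) [:: a].
Proof. by rewrite /= eqxx. Qed.

Definition arrow_path (a : arr Q) : qpath :=
  exist (fun p : vert Q * seq (arr Q) => walk p.1 p.2) (src a, [:: a])
    (arrow_path_subproof a).

(* [path_comp p q] is the path "first q, then p", when it exists. The [insub]
   never fails: see [path_compE]. *)
Definition path_comp (p q : qpath) : option qpath :=
  if path_tgt q == path_src p
  then (insub ((val q).1, (val q).2 ++ (val p).2) : option qpath) else None.

Lemma walk_cat x s1 s2 : walk x (s1 ++ s2) = walk x s1 && walk (endpoint x s1) s2.
Proof. by elim: s1 x => //= a s1 IH x; rewrite IH andbA. Qed.

Lemma endpoint_cat x s1 s2 :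
  endpoint x (s1 ++ s2) = endpoint (endpoint x s1) s2.
Proof. by rewrite /endpoint map_cat last_cat. Qed.

Lemma path_compE p q : path_tgt q = path_src p ->
  exists2 r, path_comp p q = Some r
           & val r = ((val q).1, (val q).2 ++ (val p).2).
Proof.
move=> e; rewrite /path_comp e eqxx.
have w : walk (val q).1 ((val q).2 ++ (val p).2).
  by rewrite walk_cat (valP q) -/(path_tgt q) e (valP p).
pose r : qpath := exist _ ((val q).1, (val q).2 ++ (val p).2) w.
by exists r => //; rewrite -[LHS]/(insub (val r)) valK.
Qed.

Lemma path_compN p q : path_tgt q != path_src p -> path_comp p q = None.
Proof. by rewrite /path_comp => /negPf ->. Qed.

Lemma path_comp_src p q r : path_comp p q = Some r -> path_src r = path_src q.
Proof.
case: (eqVneq (path_tgt q) (path_src p)) => [/path_compE[r' -> e] [<-]|/path_compN -> //].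
by rewrite /path_src e.
Qed.

Lemma path_comp_tgt p q r : path_comp p q = Some r -> path_tgt r = path_tgt p.
Proof.
case: (eqVneq (path_tgt q) (path_src p)) => [pq|/path_compN -> //].
case: (path_compE pq) => r' -> e [<-].
by rewrite /path_tgt e endpoint_cat -/(path_tgt q) pq.
Qed.

Lemma path_compA p q r :
  obind (path_comp p) (path_comp q r) = obind (path_comp^~ r) (path_comp p q).
Proof.
case qr: (path_comp q r) => [u|]; case pq: (path_comp p q) => [v|] //=.
- move: qr pq.
  case: (eqVneq (path_tgt r) (path_src q)) => [e1|/path_compN -> //].
  case: (eqVneq (path_tgt q) (path_src p)) => [e2|/path_compN -> //].
  case: (path_compE e1) => u' h1 E1; rewrite h1 => -[uu]; subst u'.
  case: (path_compE e2) => v' h2 E2; rewrite h2 => -[vv]; subst v'.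
  have e3 : path_tgt u = path_src p by rewrite (path_comp_tgt h1).
  have e4 : path_tgt r = path_src v by rewrite (path_comp_src h2).
  case: (path_compE e3) => a -> Ea; case: (path_compE e4) => b -> Eb.
  by congr Some; apply: val_inj; rewrite Ea Eb E1 E2 /= catA.
- apply: path_compN; apply/eqP; rewrite (path_comp_tgt qr) => e.
  by case: (path_compE e) => ?; rewrite pq.
- apply/esym/path_compN; apply/eqP; rewrite (path_comp_src pq) => e.
  by case: (path_compE e) => ?; rewrite qr.
Qed.

Lemma path_comp1p p x :
  path_comp (trivial_path x) p = if path_tgt p == x then Some p else None.
Proof.
case: eqP => [e|/eqP ne]; last exact: path_compN.
have [r -> E] := @path_compE (trivial_path x) p e.
by congr Some; apply: val_inj; rewrite E cats0 -surjective_pairing.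
Qed.

Lemma path_compp1 p x :
  path_comp p (trivial_path x) = if x == path_src p then Some p else None.
Proof.
case: eqP => [e|/eqP ne]; last exact: path_compN.
have [r -> E] := @path_compE p (trivial_path x) e.
by congr Some; apply: val_inj; rewrite E /= e -surjective_pairing.
Qed.

End Paths.

(* Linear extension to [{malg k[K]}], the vector space with basis [K], of a
   map defined on [K]. *)
Section LinearExtension.
Variables (k : fieldType) (K : choiceType).

Definition lext (V : lmodType k) (h : K -> V) (x : {malg k[K]}) : V :=
  \sum_(p <- msupp x) x@_p *: h p.

Lemma lextw (V : lmodType k) (h : K -> V) (x : {malg k[K]}) (d : {fset K}) :
  (msupp x `<=` d)%fset -> lext h x = \sum_(p <- d) x@_p *: h p.
Proof.
move=> le; rewrite /lext (big_fset_incl _ le) //= => p _.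
by move=> /mcoeff_outdom ->; rewrite scale0r.
Qed.

Lemma lextD (V : lmodType k) (h : K -> V) x y :
  lext h (x + y) = lext h x + lext h y.
Proof.
rewrite (lextw _ (msuppD_le x y)).
rewrite (lextw _ (fsubsetUl (msupp x) (msupp y))).
rewrite (lextw _ (fsubsetUr (msupp x) (msupp y))) -big_split /=.
by apply: eq_bigr => p _; rewrite mcoeffD scalerDl.
Qed.

Lemma lextZ (V : lmodType k) (h : K -> V) c x : lext h (c *: x) = c *: lext h x.
Proof.
rewrite (lextw _ (msuppZ_le c x)) /lext scaler_sumr.
by apply: eq_bigr => p _; rewrite mcoeffZ scalerA.
Qed.

Lemma lext0 (V : lmodType k) (h : K -> V) : lext h 0 = 0.
Proof. by rewrite -(scale0r 0) lextZ scale0r. Qed.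

Lemma lextU (V : lmodType k) (h : K -> V) p : lext h << p >> = h p.
Proof.
by rewrite /lext msuppU oner_eq0 big_seq_fset1 mcoeffUU scale1r.
Qed.

Lemma malgZU c (p : K) : << c *g p >> = c *: << p >> :> {malg k[K]}.
Proof.
apply/malgP => q; rewrite mcoeffZ !mcoeffU.
by rewrite mulr_natr.
Qed.

Lemma malg_ind (P : {malg k[K]} -> Prop) : P 0 ->
  (forall c p x, P x -> P (c *: << p >> + x)) -> forall x, P x.
Proof.
move=> P0 PS x; rewrite (monalgE x); elim: (enum_fset (msupp x)) => [|p s IH].
  by rewrite big_nil.
by rewrite big_cons malgZU; apply: PS.
Qed.

Lemma lext_comb (V : lmodType k) (h1 h2 : K -> V) c x :
  lext (fun p => c *: h1 p + h2 p) x = c *: lext h1 x + lext h2 x.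
Proof.
rewrite /lext scaler_sumr -big_split /=; apply: eq_bigr => p _.
by rewrite scalerDr !scalerA mulrC.
Qed.

End LinearExtension.

Definition path_algebra (k : fieldType) (Q : quiver) := {malg k[qpath Q]}.

HB.instance Definition _ (k : fieldType) (Q : quiver) :=
  GRing.Lmodule.on (path_algebra k Q).

(* [path_elt] and [palg_mul] are locked: unfolding them down to finitely
   supported functions makes unification diverge. *)
HB.lock Definition path_elt (k : fieldType) (Q : quiver) (p : qpath Q) :
    path_algebra k Q := << p >>.

Definition path_mul (k : fieldType) (Q : quiver) (p q : qpath Q) :
    path_algebra k Q :=
  if path_comp p q is Some r then path_elt k r else 0.

HB.lock Definition palg_mul (k : fieldType) (Q : quiver)
    (x y : path_algebra k Q) : path_algebra k Q :=
  lext (fun p : qpath Q => lext (fun q => path_mul k p q) y) x.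

Section PathAlgebra.
Variables (k : fieldType) (Q : quiver).
Local Notation kQ := (path_algebra k Q).

Implicit Types (x y z : kQ) (p q r : qpath Q).

Definition palg_one : kQ := \sum_(v : vert Q) path_elt k (trivial_path v).

Lemma palg_ind (P : kQ -> Prop) : P 0 ->
  (forall c p x, P x -> P (c *: path_elt k p + x)) -> forall x, P x.
Proof. rewrite path_elt.unlock; exact: malg_ind. Qed.

Lemma palg_mulUU (p q : qpath Q) :
  palg_mul (path_elt k p) (path_elt k q) = path_mul k p q.
Proof. by rewrite palg_mul.unlock path_elt.unlock !lextU. Qed.

Lemma palg_mulDl x y z : palg_mul (x + y) z = palg_mul x z + palg_mul y z.
Proof. by rewrite palg_mul.unlock; exact: lextD. Qed.

Lemma palg_mulZl c x z : palg_mul (c *: x) z = c *: palg_mul x z.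
Proof. by rewrite palg_mul.unlock; exact: lextZ. Qed.

Lemma palg_mulDZr c z x y :
  palg_mul z (c *: x + y) = c *: palg_mul z x + palg_mul z y.
Proof.
rewrite palg_mul.unlock.
apply: etrans (lext_comb (fun p : qpath Q => lext (path_mul k p) x)
  (fun p => lext (path_mul k p) y) c z).
apply: eq_bigr => p _; congr (_ *: _).
by apply: etrans (lextD _ _ _) _; congr (_ + _); apply: lextZ.
Qed.

Lemma palg_mulDr z x y : palg_mul z (x + y) = palg_mul z x + palg_mul z y.
Proof. by have := palg_mulDZr 1 z x y; rewrite !scale1r. Qed.

Lemma palg_mul0l x : palg_mul 0 x = 0.
Proof. by rewrite palg_mul.unlock; exact: lext0. Qed.

Lemma palg_mul0r x : palg_mul x 0 = 0.
Proof. by apply: (addrI (palg_mul x 0)); rewrite -palg_mulDr !addr0. Qed.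

Lemma palg_mulZr c z x : palg_mul z (c *: x) = c *: palg_mul z x.
Proof. by rewrite -[c *: x]addr0 palg_mulDZr palg_mul0r addr0. Qed.

Lemma palg_mulA : associative (@palg_mul k Q).
Proof.
elim/palg_ind => [|c p x IHx] y z; first by rewrite !palg_mul0l.
suff E y' z' : palg_mul (path_elt k p) (palg_mul y' z')
    = palg_mul (palg_mul (path_elt k p) y') z'.
  by rewrite !(palg_mulDl, palg_mulZl) IHx E.
elim/palg_ind: y' z' => [|c' q y' IHy] z'; first by rewrite !(palg_mul0l, palg_mul0r).
suff E z'' : palg_mul (path_elt k p) (palg_mul (path_elt k q) z'')
    = palg_mul (palg_mul (path_elt k p) (path_elt k q)) z''.
  by rewrite !(palg_mulDr, palg_mulDl, palg_mulZl, palg_mulZr) IHy E.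
elim/palg_ind: z'' => [|c'' r z'' IHz]; first by rewrite !palg_mul0r.
suff E : palg_mul (path_elt k p) (palg_mul (path_elt k q) (path_elt k r))
    = palg_mul (palg_mul (path_elt k p) (path_elt k q)) (path_elt k r).
  by rewrite !(palg_mulDr, palg_mulZr) IHz E.
rewrite !palg_mulUU /path_mul.
have := path_compA p q r.
case: (path_comp q r) => [u|]; case: (path_comp p q) => [v|] //= E.
- by rewrite !palg_mulUU /path_mul E.
- by rewrite palg_mulUU palg_mul0l /path_mul E.
- by rewrite palg_mulUU palg_mul0r /path_mul -E.
- by rewrite palg_mul0r palg_mul0l.
Qed.

Lemma palg_mul_suml (s : seq (vert Q)) (F : vert Q -> kQ) x :
  palg_mul (\sum_(v <- s) F v) x = \sum_(v <- s) palg_mul (F v) x.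
Proof.
elim: s => [|v s IH]; first by rewrite !big_nil palg_mul0l.
by rewrite !big_cons palg_mulDl IH.
Qed.

Lemma palg_mul_sumr (s : seq (vert Q)) (F : vert Q -> kQ) x :
  palg_mul x (\sum_(v <- s) F v) = \sum_(v <- s) palg_mul x (F v).
Proof.
elim: s => [|v s IH]; first by rewrite !big_nil palg_mul0r.
by rewrite !big_cons palg_mulDr IH.
Qed.

Lemma palg_mul1l : left_id palg_one (@palg_mul k Q).
Proof.
elim/palg_ind => [|c p x IHx]; first by rewrite palg_mul0r.
suff E : palg_mul palg_one (path_elt k p) = path_elt k p.
  by rewrite palg_mulDr palg_mulZr IHx E.
rewrite palg_mul_suml (bigD1 (path_tgt p)) //=.
rewrite palg_mulUU /path_mul path_comp1p eqxx big1 ?addr0 // => v /negPf vp.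
by rewrite palg_mulUU /path_mul path_comp1p eq_sym vp.
Qed.

Lemma palg_mul1r : right_id palg_one (@palg_mul k Q).
Proof.
elim/palg_ind => [|c p x IHx]; first by rewrite palg_mul0l.
suff E : palg_mul (path_elt k p) palg_one = path_elt k p.
  by rewrite palg_mulDl palg_mulZl IHx E.
rewrite palg_mul_sumr (bigD1 (path_src p)) //=.
rewrite palg_mulUU /path_mul path_compp1 eqxx big1 ?addr0 // => v /negPf vp.
by rewrite palg_mulUU /path_mul path_compp1 vp.
Qed.

HB.instance Definition _ := GRing.Zmodule_isPzRing.Build kQ
  palg_mulA palg_mul1l palg_mul1r palg_mulDl palg_mulDr.

End PathAlgebra.

Section QuotientRing.
Variables (A : pzRingType) (r : A).

Definition two_sided_ideal : {pred A} :=
  [pred x | `[< exists s : seq (A * A), x = \sum_(u <- s) u.1 * r * u.2 >]].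

Lemma two_sided_ideal_zmod_closed : zmod_closed two_sided_ideal.
Proof.
split=> [|x y /asboolP[s ->] /asboolP[t ->]]; apply/asboolP.
  by exists [::]; rewrite big_nil.
exists (s ++ [seq (- u.1, u.2) | u <- t]).
rewrite big_cat big_map /= -sumrN; congr (_ + _).
by apply: eq_bigr => u _; rewrite !mulNr.
Qed.

HB.instance Definition _ := GRing.isZmodClosed.Build A two_sided_ideal
  two_sided_ideal_zmod_closed.

Lemma two_sided_idealMl a x : x \in two_sided_ideal -> a * x \in two_sided_ideal.
Proof.
move=> /asboolP[s ->]; apply/asboolP; exists [seq (a * u.1, u.2) | u <- s].
by rewrite big_map mulr_sumr; apply: eq_bigr => u _; rewrite !mulrA.
Qed.

Lemma two_sided_idealMr a x : x \in two_sided_ideal -> x * a \in two_sided_ideal.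
Proof.
move=> /asboolP[s ->]; apply/asboolP; exists [seq (u.1, u.2 * a) | u <- s].
by rewrite big_map mulr_suml; apply: eq_bigr => u _; rewrite !mulrA.
Qed.

Definition quot_ring := Quotient.quot two_sided_ideal.

HB.instance Definition _ := EqQuotient.on quot_ring.
HB.instance Definition _ := GRing.Zmodule.on quot_ring.

Definition quot_proj (x : A) : quot_ring := \pi_quot_ring x.
Definition quot_mul (x y : quot_ring) : quot_ring :=
  quot_proj (repr x * repr y).

Lemma quot_projP x y : (quot_proj x = quot_proj y) <-> (x - y \in two_sided_ideal).
Proof. by split=> [/eqP|?]; [|apply/eqP]; rewrite -Quotient.idealrBE. Qed.

Lemma quot_projK x : quot_proj (repr x) = x.
Proof. exact: reprK. Qed.

Lemma quot_projD x y : quot_proj (x + y) = quot_proj x + quot_proj y.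
Proof. exact: Quotient.pi_add. Qed.

Lemma quot_projM x y : quot_proj (x * y) = quot_mul (quot_proj x) (quot_proj y).
Proof.
apply/quot_projP; set x' := repr _; set y' := repr _.
have -> : x * y - x' * y' = x * (y - y') + (x - x') * y'.
  by rewrite mulrBr mulrBl addrA subrK.
apply: rpredD; [apply: two_sided_idealMl|apply: two_sided_idealMr];
  by apply/quot_projP; rewrite quot_projK.
Qed.

Lemma quot_mulA : associative quot_mul.
Proof.
move=> x y z; rewrite -[x]quot_projK -[y]quot_projK -[z]quot_projK.
by rewrite -!quot_projM mulrA.
Qed.

Lemma quot_mul1l : left_id (quot_proj 1) quot_mul.
Proof. by move=> x; rewrite -[x]quot_projK -quot_projM mul1r. Qed.

Lemma quot_mul1r : right_id (quot_proj 1) quot_mul.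
Proof. by move=> x; rewrite -[x]quot_projK -quot_projM mulr1. Qed.

Lemma quot_mulDl : left_distributive quot_mul +%R.
Proof.
move=> x y z; rewrite -[x]quot_projK -[y]quot_projK -[z]quot_projK.
by rewrite -quot_projD -!quot_projM -quot_projD mulrDl.
Qed.

Lemma quot_mulDr : right_distributive quot_mul +%R.
Proof.
move=> x y z; rewrite -[x]quot_projK -[y]quot_projK -[z]quot_projK.
by rewrite -quot_projD -!quot_projM -quot_projD mulrDr.
Qed.

HB.instance Definition _ := GRing.Zmodule_isPzRing.Build quot_ring
  quot_mulA quot_mul1l quot_mul1r quot_mulDl quot_mulDr.

End QuotientRing.

Record category := Category {
  obj :> Type;
  hom : obj -> obj -> Type;
  idm : forall X, hom X X;
  comp : forall X Y Z, hom Y Z -> hom X Y -> hom X Z;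
  comp1m : forall X Y (f : hom X Y), comp (idm Y) f = f;
  compm1 : forall X Y (f : hom X Y), comp f (idm X) = f;
  compmA : forall X Y Z W (h : hom Z W) (g : hom Y Z) (f : hom X Y),
    comp h (comp g f) = comp (comp h g) f }.

Definition is_iso (C : category) (X Y : C) (f : hom X Y) : Prop :=
  exists g : hom Y X, comp g f = idm X /\ comp f g = idm Y.

Definition isomorphic (C : category) (X Y : C) : Prop :=
  exists f : hom X Y, is_iso f.

Record functor (C D : category) := Functor {
  fobj :> C -> D;
  fmap : forall X Y, hom X Y -> hom (fobj X) (fobj Y);
  fmap1 : forall X, fmap (idm X) = idm (fobj X);
  fmapM : forall X Y Z (g : hom Y Z) (f : hom X Y),
    fmap (comp g f) = comp (fmap g) (fmap f) }.

Definition id_functor (C : category) : functor C C :=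
  @Functor C C id (fun X Y => id) (fun X => erefl) (fun X Y Z g f => erefl).

Definition naturally_isomorphic (C D : category) (F G : functor C D) : Prop :=
  exists eta : forall X, hom (F X) (G X),
    (forall X Y (f : hom X Y), comp (eta Y) (fmap F f) = comp (fmap G f) (eta X))
    /\ (forall X, is_iso (eta X)).

Section FullSubcategory.
Variables (C : category) (P : C -> Prop).

Definition full_subcategory : category :=
  @Category {X : C | P X} (fun X Y => hom (sval X) (sval Y))
    (fun X => idm (sval X)) (fun X Y Z g f => comp g f)
    (fun X Y f => comp1m f) (fun X Y f => compm1 f)
    (fun X Y Z W h g f => compmA h g f).

Definition restrict_functor (F : functor C C) (FP : forall X, P X -> P (F X)) :
  functor full_subcategory full_subcategory :=
  @Functor full_subcategory full_subcategory
    (fun X => exist P (F (sval X)) (FP _ (proj2_sig X)))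
    (fun X Y f => fmap F f)
    (fun X => fmap1 F (sval X)) (fun X Y Z g f => fmapM F g f).

End FullSubcategory.

Lemma isomorphic_trans (C : category) (X Y Z : C) :
  isomorphic X Y -> isomorphic Y Z -> isomorphic X Z.
Proof.
move=> [f [f' [f'f ff']]] [g [g' [g'g gg']]].
exists (comp g f), (comp f' g'); split.
  by rewrite compmA -(compmA f') g'g compm1.
by rewrite compmA -(compmA g) ff' compm1.
Qed.

Lemma functor_isomorphic (C D : category) (F : functor C D) (X Y : C) :
  isomorphic X Y -> isomorphic (F X) (F Y).
Proof.
move=> [f [g [gf fg]]]; exists (fmap F f), (fmap F g).
by rewrite -!fmapM gf fg !fmap1.
Qed.

(* Right [R]-modules are left modules over the converse ring [R^c]. *)
Notation rmodType R := (lmodType R^c).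

Section Projective.
Variables (R : pzRingType) (P : lmodType R).

Definition finitely_generated : Prop :=
  exists n (g : 'I_n -> P), forall x, exists c : 'I_n -> R,
    x = \sum_i c i *: g i.

Definition projective : Prop :=
  forall (M N : lmodType R) (g : {linear M -> N}) (f : {linear P -> N}),
    (forall y, exists x, g x = y) ->
    exists h : {linear P -> M}, forall x, g (h x) = f x.

End Projective.

Section DirectSum.
Variables (R : pzRingType) (I : choiceType) (X : I -> lmodType R).

Record dsum := DSum {
  dval :> forall i, X i;
  dfin : exists s : seq I, forall i, i \notin s -> dval i = 0 }.

Lemma dsumP (x y : dsum) : (forall i, x i = y i) -> x = y.
Proof.
case: x y => [x hx] [y hy] /= xy.
have e : x = y by apply: functional_extensionality_dep.
by subst y; congr DSum; apply: Prop_irrelevance.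
Qed.

HB.instance Definition _ := gen_eqMixin dsum.
HB.instance Definition _ := gen_choiceMixin dsum.

Lemma dsum0_fin : exists s : seq I, forall i, i \notin s -> 0 = 0 :> X i.
Proof. by exists [::]. Qed.
Definition dsum0 := DSum dsum0_fin.

Lemma dsumN_fin (x : dsum) :
  exists s : seq I, forall i, i \notin s -> - x i = 0.
Proof. by case: (dfin x) => s hs; exists s => i /hs ->; rewrite oppr0. Qed.
Definition dsumN x := DSum (dsumN_fin x).

Lemma dsumD_fin (x y : dsum) :
  exists s : seq I, forall i, i \notin s -> x i + y i = 0.
Proof.
case: (dfin x) (dfin y) => s hs [t ht]; exists (s ++ t) => i.
by rewrite mem_cat negb_or => /andP[/hs -> /ht ->]; rewrite addr0.
Qed.
Definition dsumD x y := DSum (dsumD_fin x y).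

Lemma dsumZ_fin (c : R) (x : dsum) :
  exists s : seq I, forall i, i \notin s -> c *: x i = 0.
Proof. by case: (dfin x) => s hs; exists s => i /hs ->; rewrite scaler0. Qed.
Definition dsumZ c x := DSum (dsumZ_fin c x).

Lemma dsumDA : associative dsumD.
Proof. by move=> x y z; apply: dsumP => i /=; rewrite addrA. Qed.
Lemma dsumDC : commutative dsumD.
Proof. by move=> x y; apply: dsumP => i /=; rewrite addrC. Qed.
Lemma dsum0D : left_id dsum0 dsumD.
Proof. by move=> x; apply: dsumP => i /=; rewrite add0r. Qed.
Lemma dsumND : left_inverse dsum0 dsumN dsumD.
Proof. by move=> x; apply: dsumP => i /=; rewrite addNr. Qed.
HB.instance Definition _ :=
  GRing.isZmodule.Build dsum dsumDA dsumDC dsum0D dsumND.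

Lemma dsumZA a b (x : dsum) : dsumZ a (dsumZ b x) = dsumZ (a * b) x.
Proof. by apply: dsumP => i /=; rewrite scalerA. Qed.
Lemma dsum1Z : left_id 1 dsumZ.
Proof. by move=> x; apply: dsumP => i /=; rewrite scale1r. Qed.
Lemma dsumZDr : right_distributive dsumZ +%R.
Proof. by move=> a x y; apply: dsumP => i /=; rewrite scalerDr. Qed.
Lemma dsumZDl (x : dsum) : {morph dsumZ^~ x : a b / a + b}.
Proof. by move=> a b; apply: dsumP => i /=; rewrite scalerDl. Qed.
HB.instance Definition _ :=
  GRing.Zmodule_isLmodule.Build R dsum dsumZA dsum1Z dsumZDr dsumZDl.

Lemma dsumDE (x y : dsum) i : (x + y) i = x i + y i. Proof. by []. Qed.
Lemma dsumNE (x : dsum) i : (- x) i = - x i. Proof. by []. Qed.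
Lemma dsumZE c (x : dsum) i : (c *: x) i = c *: x i. Proof. by []. Qed.
Lemma dsum0E i : (0 : dsum) i = 0. Proof. by []. Qed.

Definition dinj_fun (i : I) (x : X i) (j : I) : X j :=
  if i =P j is ReflectT e then ecast j (X j) e x else 0.

Lemma dinj_fun_id i (x : X i) : dinj_fun x i = x.
Proof. by rewrite /dinj_fun; case: eqP => // e; rewrite (eq_axiomK e). Qed.

Lemma dinj_fun_neq i (x : X i) j : i != j -> dinj_fun x j = 0.
Proof. by rewrite /dinj_fun; case: eqP. Qed.

Lemma dinj_fin i (x : X i) :
  exists s : seq I, forall j, j \notin s -> dinj_fun x j = 0.
Proof.
exists [:: i] => j; rewrite inE eq_sym; exact: dinj_fun_neq.
Qed.
Definition dinj i (x : X i) : dsum := DSum (dinj_fin x).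

Lemma dinj_is_linear i : linear (@dinj i).
Proof.
move=> a x y; apply: dsumP => j; rewrite dsumDE dsumZE /=.
have [e|ne] := eqVneq i j; first by subst j; rewrite !dinj_fun_id.
by rewrite !dinj_fun_neq // scaler0 addr0.
Qed.
HB.instance Definition _ i :=
  GRing.isLinear.Build R (X i) dsum *:%R (@dinj i) (@dinj_is_linear i).

Lemma dsum_split (s : seq I) (x : dsum) : uniq s ->
  (forall i, i \notin s -> x i = 0) -> x = \sum_(i <- s) dinj (x i).
Proof.
elim: s x => [|i s IH] x /=.
  by move=> _ h; rewrite big_nil; apply: dsumP => i; rewrite h.
move=> /andP[nis us] h; rewrite big_cons.
have hx j : j \notin s -> (x - dinj (x i)) j = 0.
  move=> js; rewrite dsumDE dsumNE /=.
  have [e|ne] := eqVneq i j; first by subst j; rewrite dinj_fun_id subrr.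
  by rewrite dinj_fun_neq // subr0 h // inE eq_sym negb_or ne.
apply: (addIr (- dinj (x i))); rewrite [RHS]addrAC subrr add0r (IH _ us hx).
rewrite big_seq [RHS]big_seq; apply: eq_bigr => j js.
rewrite dsumDE dsumNE /= dinj_fun_neq ?subr0 //.
by apply: contraNneq nis => ->.
Qed.

Variable s : seq I.
Hypothesis Xs : forall i, i \notin s -> forall x : X i, x = 0.

Lemma dsum_finitely_generated :
  (forall i, finitely_generated (X i)) -> finitely_generated dsum.
Proof.
move=> fgX.
suff H (t : seq I) : uniq t -> exists n (g : 'I_n -> dsum), forall x : dsum,
    (forall i, i \notin t -> x i = 0) ->
    exists c : 'I_n -> R, x = \sum_i c i *: g i.
  have [n [g hg]] := H _ (undup_uniq s); exists n, g => x.
  by apply: hg => i; rewrite mem_undup => /Xs.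
elim: t => [|i t IH] /=.
  move=> _; exists 0%N, (fun=> 0) => x h; exists (fun=> 0).
  by rewrite big_ord0; apply: dsumP => i; rewrite h.
move=> /andP[it ut]; have {IH} [n [g hg]] := IH ut.
have [m [e he]] := fgX i.
exists (m + n)%N, (fun u => match split u with
  inl a => dinj (e a) | inr b => g b end) => x hx.
have [c hc] := he (x i).
have [|d hd] := hg (x - dinj (x i)).
  move=> j jt; rewrite dsumDE dsumNE /=.
  have [E|ne] := eqVneq i j; first by subst j; rewrite dinj_fun_id subrr.
  by rewrite dinj_fun_neq // subr0 hx // inE eq_sym negb_or ne.
exists (fun u => match split u with inl a => c a | inr b => d b end).
rewrite big_split_ord /=.
under eq_bigr => a _ do rewrite (unsplitK (inl a)).
under [X in _ + X]eq_bigr => b _ do rewrite (unsplitK (inr b)).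
rewrite -hd -[LHS](subrK (dinj (x i))) addrC; congr (_ + _).
by rewrite {1}hc linear_sum; apply: eq_bigr => a _; rewrite linearZ.
Qed.

Lemma dsum_projective : (forall i, projective (X i)) -> projective dsum.
Proof.
move=> pX M N g f gsurj.
have hP i : exists h : {linear X i -> M}, forall x, g (h x) = f (dinj x).
  exact: (pX i M N g (f \o @dinj i) gsurj).
pose h i : {linear X i -> M} := sval (cid (hP i)).
have hE i x : g (h i x) = f (dinj x) by exact: (svalP (cid (hP i))).
pose H (x : dsum) : M := \sum_(i <- undup s) h i (x i).
have lH : linear H.
  move=> a x y; rewrite /H scaler_sumr -big_split /=.
  by apply: eq_bigr => i _; rewrite linearP.
pose HL := HB.pack_for {linear dsum -> M} H
  (GRing.isLinear.Build R dsum M *:%R H lH).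
exists HL => x /=.
rewrite /HL /= /H [in RHS](dsum_split (undup_uniq s) (x := x)); last first.
  by move=> i; rewrite mem_undup => /Xs.
by rewrite !linear_sum; apply: eq_bigr => i _; rewrite hE.
Qed.

End DirectSum.

Section K1.
Variable R : pzRingType.

Record diffproj := DiffProj {
  carrier :> rmodType R;
  diff : {linear carrier -> carrier};
  carrier_fg : finitely_generated carrier;
  carrier_proj : projective carrier;
  diffK : forall x, diff (diff x) = 0 }.

Record chain_map (P Q : diffproj) := ChainMap {
  cmap :> {linear P -> Q};
  cmapE : forall x, cmap (diff P x) = diff Q (cmap x) }.

HB.instance Definition _ P Q := gen_eqMixin (chain_map P Q).
HB.instance Definition _ P Q := gen_choiceMixin (chain_map P Q).

Definition homotopic (P Q : diffproj) (f g : chain_map P Q) : bool :=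
  `[< exists s : {linear P -> Q},
        forall x, f x - g x = s (diff P x) + diff Q (s x) >].

Lemma homotopic_equiv P Q : equiv_class_of (@homotopic P Q).
Proof.
have hN f g : homotopic f g -> @homotopic P Q g f.
  move=> /asboolP[s hs]; apply/asboolP; exists (\- s) => x /=.
  by rewrite -opprB hs opprD linearN.
split=> [f|f g|g f h].
- apply/asboolP; exists \0 => x /=.
  by rewrite subrr linear0 addr0.
- by apply/idP/idP; apply: hN.
- move=> /asboolP[s hs] /asboolP[t ht]; apply/asboolP.
  exists (s \+ t) => x /=.
  by rewrite linearD addrACA -hs -ht addrA subrK.
Qed.

Canonical homotopic_equivRel P Q := EquivRelPack (@homotopic_equiv P Q).
Canonical homotopic_encModRel P Q := defaultEncModRel (@homotopic P Q).

Definition khom (P Q : diffproj) := {eq_quot (@homotopic P Q)}.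

Definition hclass P Q (f : chain_map P Q) : khom P Q := \pi_(khom P Q) f.

Lemma hclassP P Q (f g : chain_map P Q) :
  hclass f = hclass g <-> exists s : {linear P -> Q},
    forall x, f x - g x = s (diff P x) + diff Q (s x).
Proof.
split=> [/eqP|h]; first by rewrite eqmodE => /asboolP.
by apply/eqP; rewrite eqmodE; apply/asboolP.
Qed.

Lemma hclass_repr P Q (f : khom P Q) : hclass (repr f) = f.
Proof. exact: reprK. Qed.

Lemma repr_hclass P Q (f : chain_map P Q) : exists s : {linear P -> Q},
  forall x, repr (hclass f) x - f x = s (diff P x) + diff Q (s x).
Proof. by apply/hclassP; rewrite hclass_repr. Qed.

Lemma hclass_eq P Q (f g : chain_map P Q) : f =1 g -> hclass f = hclass g.
Proof.
by move=> fg; apply/hclassP; exists \0 => x; rewrite fg subrr /= linear0 addr0.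
Qed.

Definition cid_map (P : diffproj) : chain_map P P :=
  @ChainMap P P idfun (fun x => erefl).

Lemma ccomp_subproof P Q S (g : chain_map Q S) (f : chain_map P Q) x :
  (g \o f) (diff P x) = diff S ((g \o f) x).
Proof. by rewrite /= !cmapE. Qed.

Definition ccomp P Q S (g : chain_map Q S) (f : chain_map P Q) : chain_map P S :=
  @ChainMap P S (g \o f) (ccomp_subproof g f).

Definition kcomp P Q S (g : khom Q S) (f : khom P Q) : khom P S :=
  hclass (ccomp (repr g) (repr f)).

Lemma kcompE P Q S (g : chain_map Q S) (f : chain_map P Q) :
  kcomp (hclass g) (hclass f) = hclass (ccomp g f).
Proof.
have [s hs] := repr_hclass g; have [t ht] := repr_hclass f.
apply/hclassP; exists ((s \o repr (hclass f)) \+ (g \o t)) => x /=.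
set g' := repr _ in hs *; set f' := repr _ in ht *.
have -> : g' (f' x) - g (f x) = (g' (f' x) - g (f' x)) + g (f' x - f x).
  by rewrite linearB addrA subrK.
by rewrite hs ht !linearD /= !cmapE addrACA.
Qed.

Lemma kcomp1m P Q (f : khom P Q) : kcomp (hclass (cid_map Q)) f = f.
Proof. by rewrite -[f]hclass_repr kcompE; apply: hclass_eq. Qed.

Lemma kcompm1 P Q (f : khom P Q) : kcomp f (hclass (cid_map P)) = f.
Proof. by rewrite -[f]hclass_repr kcompE; apply: hclass_eq. Qed.

Lemma kcompA P Q S T (h : khom S T) (g : khom Q S) (f : khom P Q) :
  kcomp h (kcomp g f) = kcomp (kcomp h g) f.
Proof.
rewrite -[f]hclass_repr -[g]hclass_repr -[h]hclass_repr !kcompE.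
exact: hclass_eq.
Qed.

Definition K1 : category := @Category diffproj khom
  (fun P => hclass (cid_map P)) kcomp kcomp1m kcompm1 kcompA.

Lemma susp_diffK (P : diffproj) (x : P) : (\- diff P) ((\- diff P) x) = 0.
Proof. by rewrite /= linearN opprK diffK. Qed.

Definition susp_obj (P : diffproj) : diffproj :=
  @DiffProj P (\- diff P) (carrier_fg P) (@carrier_proj P) (@susp_diffK P).

Lemma susp_map_subproof P Q (f : chain_map P Q) x :
  f (diff (susp_obj P) x) = diff (susp_obj Q) (f x).
Proof. by rewrite /= linearN cmapE. Qed.

Definition susp_map P Q (f : chain_map P Q) :
  chain_map (susp_obj P) (susp_obj Q) :=
  @ChainMap (susp_obj P) (susp_obj Q) f (susp_map_subproof f).

Definition susp_hom P Q (f : khom P Q) : khom (susp_obj P) (susp_obj Q) :=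
  hclass (susp_map (repr f)).

Lemma susp_homE P Q (f : chain_map P Q) :
  susp_hom (hclass f) = hclass (susp_map f).
Proof.
have [s hs] := repr_hclass f.
apply/hclassP; exists (\- s) => x /=.
by rewrite hs !linearN !opprK.
Qed.

Lemma susp_hom1 P : susp_hom (hclass (cid_map P)) = hclass (cid_map (susp_obj P)).
Proof. by rewrite susp_homE; apply: hclass_eq. Qed.

Lemma susp_homM P Q S (g : khom Q S) (f : khom P Q) :
  susp_hom (kcomp g f) = kcomp (susp_hom g) (susp_hom f).
Proof.
rewrite -[f]hclass_repr -[g]hclass_repr kcompE !susp_homE kcompE.
exact: hclass_eq.
Qed.

Definition Sigma : functor K1 K1 :=
  @Functor K1 K1 susp_obj susp_hom susp_hom1 susp_homM.

(* The component of the differential with target [bcx i] is [bdiff i]; this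
   indexing avoids transport along [i - 1 + 1 = i]. *)
Record bounded_complex := BoundedComplex {
  bcx : int -> rmodType R;
  bdiff : forall i, {linear bcx (i - 1) -> bcx i};
  bdiffK : forall i x, bdiff i (bdiff (i - 1) x) = 0;
  bcx_fg : forall i, finitely_generated (bcx i);
  bcx_proj : forall i, projective (bcx i);
  bcx_bounded : exists n : nat,
    forall i, (n < `|i|)%N -> forall x : bcx i, x = 0 }.

Section Compression.
Variable X : bounded_complex.

Lemma bcx_support :
  exists s : seq int, forall i, i \notin s -> forall x : bcx X i, x = 0.
Proof.
have [n hn] := bcx_bounded X.
exists ([seq Posz j | j <- iota 0 n.+1] ++ [seq - Posz j | j <- iota 0 n.+1]).
move=> i; rewrite mem_cat negb_or => /andP[h1 h2]; apply: hn.
rewrite ltnNge; apply/negP => le.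
case: i h1 h2 le => j h1 h2 le.
  by move/negP: h1; apply; apply: map_f; rewrite mem_iota.
move/negP: h2; apply; rewrite NegzE; apply: (map_f (fun j => - Posz j)).
by rewrite mem_iota.
Qed.

Lemma compress_diff_fin (x : dsum (bcx X)) :
  exists s : seq int, forall i, i \notin s -> bdiff X i (x (i - 1)) = 0.
Proof.
have [s hs] := dfin x; exists [seq j + 1 | j <- s] => i hi.
rewrite hs ?linear0 //; apply: contraNN hi => hi.
by apply/mapP; exists (i - 1); rewrite // subrK.
Qed.

Definition compress_diff (x : dsum (bcx X)) : dsum (bcx X) :=
  DSum (compress_diff_fin x).

Lemma compress_diff_is_linear : linear compress_diff.
Proof.
by move=> a x y; apply: dsumP => i; rewrite dsumDE dsumZE /= linearP.
Qed.

HB.instance Definition _ := GRing.isLinear.Build R^c (dsum (bcx X))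
  (dsum (bcx X)) *:%R compress_diff compress_diff_is_linear.

Lemma compress_fg : finitely_generated (dsum (bcx X)).
Proof.
have [s hs] := bcx_support.
exact: (dsum_finitely_generated hs (bcx_fg X)).
Qed.

Lemma compress_proj : projective (dsum (bcx X)).
Proof.
have [s hs] := bcx_support.
exact: (dsum_projective hs (@bcx_proj X)).
Qed.

Lemma compress_diffK x : compress_diff (compress_diff x) = 0.
Proof. by apply: dsumP => i /=; rewrite bdiffK. Qed.

Definition compression : diffproj :=
  @DiffProj (dsum (bcx X)) compress_diff compress_fg compress_proj compress_diffK.

End Compression.

Definition gradable (P : K1) : Prop :=
  exists X : bounded_complex, isomorphic P (compression X : K1).

Lemma bopp_subproof (X : bounded_complex) i (x : bcx X (i - 1 - 1)) :
  (\- bdiff X i) ((\- bdiff X (i - 1)) x) = 0.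
Proof. by rewrite /= linearN opprK bdiffK. Qed.

Definition bopp (X : bounded_complex) : bounded_complex :=
  @BoundedComplex (bcx X) (fun i => \- bdiff X i) (@bopp_subproof X)
    (bcx_fg X) (@bcx_proj X) (bcx_bounded X).

Lemma Sigma_compression X :
  isomorphic (Sigma (compression X)) (compression (bopp X) : K1).
Proof.
have h1 (x : susp_obj (compression X)) :
    idfun (diff (susp_obj (compression X)) x)
    = diff (compression (bopp X)) (idfun x).
  by apply: dsumP => i.
have h2 (x : compression (bopp X)) :
    idfun (diff (compression (bopp X)) x)
    = diff (susp_obj (compression X)) (idfun x).
  by apply: dsumP => i.
exists (hclass (@ChainMap (susp_obj (compression X)) (compression (bopp X)) idfun h1)).
exists (hclass (@ChainMap (compression (bopp X)) (susp_obj (compression X)) idfun h2)).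
by split; rewrite /= kcompE; apply: hclass_eq.
Qed.

Lemma gradable_Sigma (P : K1) : gradable P -> gradable (Sigma P).
Proof.
move=> [X PX]; exists (bopp X).
exact: isomorphic_trans (functor_isomorphic Sigma PX) (Sigma_compression X).
Qed.

(* For a finite-dimensional algebra R of finite global dimension, such as
   [Lambda k] below, compression identifies the orbit category D^b(mod R)/Sigma
   with this category. *)
Definition gradable_category : category := full_subcategory gradable.

Definition gradable_suspension : functor gradable_category gradable_category :=
  restrict_functor gradable_Sigma.

End K1.

Inductive vertex := v1 | v2 | v3.
Inductive arrow := alpha | beta | gamma.

Definition vertex_code (v : vertex) : 'I_3 :=
  match v with v1 => inord 0 | v2 => inord 1 | v3 => inord 2 end.
Definition vertex_decode (i : 'I_3) : vertex := nth v1 [:: v1; v2; v3] i.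
Lemma vertex_codeK : cancel vertex_code vertex_decode.
Proof. by case; rewrite /vertex_decode /= inordK. Qed.
HB.instance Definition _ := Finite.copy vertex (can_type vertex_codeK).

Definition arrow_code (a : arrow) : 'I_3 :=
  match a with alpha => inord 0 | beta => inord 1 | gamma => inord 2 end.
Definition arrow_decode (i : 'I_3) : arrow := nth alpha [:: alpha; beta; gamma] i.
Lemma arrow_codeK : cancel arrow_code arrow_decode.
Proof. by case; rewrite /arrow_decode /= inordK. Qed.
HB.instance Definition _ := Finite.copy arrow (can_type arrow_codeK).

Definition triangle : quiver := @Quiver vertex arrow
  (fun a => match a with alpha => v1 | beta => v2 | gamma => v1 end)
  (fun a => match a with alpha => v2 | beta => v3 | gamma => v3 end).

Definition arrow_elt (k : fieldType) (a : arrow) : path_algebra k triangle :=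
  path_elt k (arrow_path (a : arr triangle)).

(* Products of paths compose from right to left, so this product is the path
   "first alpha, then beta". *)
Definition Lambda (k : fieldType) : pzRingType :=
  quot_ring (arrow_elt k beta * arrow_elt k alpha).

(* Main.v *)
From HB Require Import structures.
Require Import Defs.
From mathcomp Require Import all_boot all_algebra.
From mathcomp Require Import boolp monalg.

Set Implicit Arguments.
Unset Strict Implicit.
Unset Printing Implicit Defensive.

Import GRing.Theory.
Local Open Scope ring_scope.

(** The suspension changes the sign of differentials but not of morphisms, and
a mapping cone detects the discrepancy.  Let [A : M -> N] be a map of finitely
generated projective modules, regarded as a morphism between objects with zero
differential, and let [C] be its cone, that is [M] plus [N] with differential
[A].  Suppose [eta] is a natural isomorphism from the suspension to the
identity.

The morphism [A], the inclusion [N -> C] and the projection [C -> M] are fixed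
by the suspension, so naturality forces [eta] to act on the two summands of [C]
as it acts on [N] and on [M], and these two actions agree along [A].  On the
other hand, [eta] at [C] goes from the cone with differential [-A] to the cone
with differential [A], so its actions on the two summands must have opposite
signs along [A].  The equalities coming from naturality hold only up to
homotopy, but the homotopies contribute terms [A h A] with [h : N -> M].  If all
of these vanish, the two requirements give [2 A = 0] ([suspension_sign]).

For [M = N] the ring itself, [A] can be multiplication by an element [a] with
[a R a = 0]; hence the suspension is not isomorphic to the identity as soon as
[2 a] is nonzero ([suspension_not_identity]).  In the algebra of the triangle
with relation [beta alpha], the arrow [alpha] is such an element: no path leads
from its target back to its source ([path_elt_sandwich]), and [2 alpha] is not
in the ideal, whose elements only involve paths of length at least two
([path_coeff_ideal]). *)

(** * Isomorphisms between objects with differential *)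

Lemma isomorphic_refl (C : category) (X : C) : isomorphic X X.
Proof. by exists (idm X), (idm X); rewrite comp1m. Qed.

Lemma bijective_chain_map_isomorphic (R : pzRingType) (P Q : diffproj R)
    (f : {linear P -> Q}) (g : {linear Q -> P}) :
  cancel f g -> cancel g f -> (forall x, f (diff P x) = diff Q (f x)) ->
  isomorphic (P : K1 R) (Q : K1 R).
Proof.
move=> fK gK fd.
have gd y : g (diff Q y) = diff P (g y) by rewrite -{1}[y]gK -fd fK.
exists (hclass (ChainMap fd)), (hclass (ChainMap gd)).
by split; rewrite /= kcompE; apply: hclass_eq => x /=; rewrite ?fK ?gK.
Qed.

(** * Two-term complexes and stalks *)

Section ZeroModule.
Variable R : pzRingType.

Lemma zero_module_fg : finitely_generated ('rV[R^c]_0 : rmodType R).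
Proof.
by exists 0%N, (fun=> 0) => x; exists (fun=> 0); rewrite big_ord0 thinmx0.
Qed.

Lemma zero_module_projective : projective ('rV[R^c]_0 : rmodType R).
Proof. by move=> M N g f _; exists \0 => x; rewrite (thinmx0 x) !linear0. Qed.

End ZeroModule.

Section TwoTerm.
Variables (R : pzRingType) (M N : rmodType R) (A : {linear M -> N}).
Hypotheses (fgM : finitely_generated M) (projM : projective M).
Hypotheses (fgN : finitely_generated N) (projN : projective N).

Definition two_term_module (i : int) : rmodType R :=
  match i with Posz 0 => M | Posz 1 => N | _ => 'rV[R^c]_0 end.

Definition two_term_diff (i : int) :
    {linear two_term_module (i - 1) -> two_term_module i} :=
  match i with Posz 1 => A | _ => \0 end.

Lemma two_term_diffK i x : two_term_diff i (two_term_diff (i - 1) x) = 0.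
Proof. by case: i x => [[|[|n]]|n] x //=; apply: linear0. Qed.

Lemma two_term_fg i : finitely_generated (two_term_module i).
Proof. by case: i => [[|[|n]]|n] //; apply: zero_module_fg. Qed.

Lemma two_term_proj i : projective (two_term_module i).
Proof. by case: i => [[|[|n]]|n] //; apply: zero_module_projective. Qed.

Lemma two_term_bounded : exists n : nat,
  forall i, (n < `|i|)%N -> forall x : two_term_module i, x = 0.
Proof. by exists 1%N; case=> [[|[|n]]|n] //= _ x; apply: thinmx0. Qed.

Definition two_term : bounded_complex R :=
  BoundedComplex two_term_diffK two_term_fg two_term_proj two_term_bounded.

Local Notation C := (compression two_term).

Definition two_term_in0 (x : M) : C := @dinj R^c _ two_term_module 0 x.
Definition two_term_in1 (y : N) : C := @dinj R^c _ two_term_module 1 y.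
Definition two_term_pr0 (z : C) : M := z 0.

Lemma two_term_in0_linear : linear two_term_in0.
Proof. exact: (@dinj_is_linear R^c _ two_term_module 0). Qed.
Lemma two_term_in1_linear : linear two_term_in1.
Proof. exact: (@dinj_is_linear R^c _ two_term_module 1). Qed.
Lemma two_term_pr0_linear : linear two_term_pr0.
Proof. by []. Qed.
HB.instance Definition _ := GRing.isLinear.Build R^c M C
  *:%R two_term_in0 two_term_in0_linear.
HB.instance Definition _ := GRing.isLinear.Build R^c N C
  *:%R two_term_in1 two_term_in1_linear.
HB.instance Definition _ := GRing.isLinear.Build R^c C M
  *:%R two_term_pr0 two_term_pr0_linear.

Lemma two_term_in0K : cancel two_term_in0 two_term_pr0.
Proof. exact: (@dinj_fun_id R^c _ two_term_module 0). Qed.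

Lemma two_term_in1_inj : injective two_term_in1.
Proof.
move=> x y /(congr1 (fun z : C => z 1)).
by rewrite /= !(@dinj_fun_id R^c _ two_term_module 1).
Qed.

Lemma two_term_pr0_in1 y : two_term_pr0 (two_term_in1 y) = 0.
Proof. exact: (@dinj_fun_neq R^c _ two_term_module 1 y 0). Qed.

Lemma two_term_diffE (z : C) : diff C z = two_term_in1 (A (two_term_pr0 z)).
Proof.
apply: dsumP => i.
case: i => [[|[|n]]|n].
- by rewrite [RHS](@dinj_fun_neq R^c _ two_term_module 1).
- by rewrite [RHS](@dinj_fun_id R^c _ two_term_module 1).
- by apply: etrans (thinmx0 _) (esym (thinmx0 _)).
- by apply: etrans (thinmx0 _) (esym (thinmx0 _)).
Qed.

Lemma two_term_in0_pr0 (z : C) : (forall y : N, y = 0) ->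
  two_term_in0 (two_term_pr0 z) = z.
Proof.
move=> N0; apply: dsumP => i.
case: i => [[|[|n]]|n].
- exact: (@dinj_fun_id R^c _ two_term_module 0).
- by rewrite [RHS]N0 [LHS]N0.
- by apply: etrans (thinmx0 _) (esym (thinmx0 _)).
- by apply: etrans (thinmx0 _) (esym (thinmx0 _)).
Qed.

End TwoTerm.

Section Stalk.
Variables (R : pzRingType) (M : rmodType R).
Hypotheses (fgM : finitely_generated M) (projM : projective M).

Lemma stalk_diffK (x : M) :
  (\0 : {linear M -> M}) ((\0 : {linear M -> M}) x) = 0.
Proof. by []. Qed.

Definition stalk : diffproj R := DiffProj fgM projM stalk_diffK.

Lemma stalk_gradable : gradable (stalk : K1 R).
Proof.
pose Z : rmodType R := 'rV[R^c]_0; pose A : {linear M -> Z} := \0.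
have fgZ : finitely_generated Z := zero_module_fg R.
have projZ : projective Z := @zero_module_projective R.
exists (two_term A fgM projM fgZ projZ).
apply: (@bijective_chain_map_isomorphic R stalk
  (compression (two_term A fgM projM fgZ projZ))
  (@two_term_in0 R M Z A fgM projM fgZ projZ)
  (@two_term_pr0 R M Z A fgM projM fgZ projZ)).
- exact: two_term_in0K.
- by move=> z; apply: two_term_in0_pr0 => y; apply: thinmx0.
- by move=> x; rewrite two_term_diffE !linear0.
Qed.

End Stalk.

(** * The sign obstruction *)

Section SuspensionSign.
Variables (R : pzRingType) (M N : rmodType R) (A : {linear M -> N}).
Hypotheses (fgM : finitely_generated M) (projM : projective M).
Hypotheses (fgN : finitely_generated N) (projN : projective N).

(** Restricted to the image of [A] in the second summand of the cone, the
component of the natural isomorphism at the cone is its component [u] at [N]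
by naturality, and is [- u] because it anticommutes with the differential; so
[u] kills [2 A], and [u] is injective. *)
Lemma suspension_sign (x : M) :
  naturally_isomorphic (gradable_suspension R)
    (id_functor (gradable_category R)) ->
  (forall (h : {linear N -> M}) y, A (h (A y)) = 0) -> A x + A x = 0.
Proof.
move=> [eta [eta_nat eta_iso]] AhA.
pose PM := stalk fgM projM; pose PN := stalk fgN projN.
pose C := compression (two_term A fgM projM fgN projN).
pose gM : gradable_category R :=
  exist _ (PM : K1 R) (stalk_gradable fgM projM).
pose gN : gradable_category R :=
  exist _ (PN : K1 R) (stalk_gradable fgN projN).
have gradC : gradable (C : K1 R).
  by exists (two_term A fgM projM fgN projN); apply: isomorphic_refl.
pose gC : gradable_category R := exist _ (C : K1 R) gradC.
pose u (X : gradable_category R) : chain_map (susp_obj (sval X)) (sval X) :=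
  repr (eta X).
have nat (X Y : gradable_category R) (f : chain_map (sval X) (sval Y)) :
    exists s : {linear sval X -> sval Y}, forall z,
      u Y (f z) - f (u X z) = s (- diff (sval X) z) + diff (sval Y) (s z).
  have := eta_nat X Y (hclass f).
  rewrite /= susp_homE -[eta X]hclass_repr -[eta Y]hclass_repr !kcompE.
  by move=> /hclassP.
pose i0 : {linear M -> C} := @two_term_in0 R M N A fgM projM fgN projN.
pose i1 : {linear N -> C} := @two_term_in1 R M N A fgM projM fgN projN.
pose p0 : {linear C -> M} := @two_term_pr0 R M N A fgM projM fgN projN.
have dC z : diff C z = i1 (A (p0 z)) by apply: two_term_diffE.
have p0i1 y : p0 (i1 y) = 0 by apply: two_term_pr0_in1.
have p0i0 y : p0 (i0 y) = y by apply: two_term_in0K.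
have cA y : A (diff PM y) = diff PN (A y) by exact: linear0.
have ci y : i1 (diff PN y) = diff C (i1 y) by rewrite dC p0i1 !linear0.
have cp z : p0 (diff C z) = diff PM (p0 z) by rewrite dC p0i1.
have uA y : u gN (A y) = A (u gM y).
  have [s hs] := nat gM gN (@ChainMap R PM PN A cA).
  by apply/subr0_eq; rewrite hs /= oppr0 linear0 addr0.
(* Here and in [p0u], precomposing or postcomposing with [A] turns the homotopy
   term into some [A h A]. *)
have ui1 y : u gC (i1 (A y)) = i1 (u gN (A y)).
  have [t ht] := nat gN gC (@ChainMap R PN C i1 ci).
  apply/subr0_eq; rewrite ht /= oppr0 linear0 add0r dC.
  by rewrite (AhA (p0 \o t)) linear0.
have p0u y : A (p0 (u gC (i0 y))) = A (u gM y).
  have [r hr] := nat gC gM (@ChainMap R C PM p0 cp).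
  apply/esym/subr0_eq; rewrite -linearB -{1}[y]p0i0 hr /= addr0 dC p0i0.
  by rewrite !linearN (AhA (r \o i1)) oppr0.
(* Between objects with zero differential, homotopic maps are equal. *)
have uN_inj y : u gN y = 0 -> y = 0.
  have [g [gu _]] := eta_iso gN; move: gu.
  rewrite /= -[eta gN]hclass_repr -[g]hclass_repr kcompE => /hclassP[h hh] uy.
  have := hh y; rewrite /= oppr0 linear0 addr0 => /subr0_eq <-.
  by rewrite -/(u gN) uy linear0.
apply: uN_inj; rewrite linearD.
have := cmapE (u gC) (i0 x); rewrite /= linearN !dC p0i0 ui1 p0u -uA.
by rewrite -linearN => /two_term_in1_inj E; rewrite -{1}E addNr.
Qed.

End SuspensionSign.

Section Regular.
Variable R : pzRingType.

Lemma regular_fg : finitely_generated (R^c^o : rmodType R).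
Proof.
exists 1%N, (fun=> 1) => x; exists (fun=> x).
by rewrite big_ord1 [RHS]mulr1.
Qed.

Lemma regular_projective : projective (R^c^o : rmodType R).
Proof.
move=> M N g f gsurj; have [m gm] := gsurj (f 1).
have lin : linear (fun x : R^c^o => (x : R^c) *: m).
  by move=> a x y; rewrite scalerDl scalerA.
pose h := HB.pack_for {linear R^c^o -> M} (fun x : R^c^o => (x : R^c) *: m)
  (GRing.isLinear.Build R^c R^c^o M *:%R _ lin).
exists h => x; rewrite /h /= linearZ gm -linearZ; congr (f _).
exact: mulr1.
Qed.

(** Endomorphisms of the regular right module are left multiplications, so the
composites [A h A] for [A] the multiplication by [a] are multiplications by
elements of [a R a]. *)
Lemma suspension_not_identity (a : R) :
  (forall x, a * x * a = 0) -> a + a != 0 ->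
  ~ naturally_isomorphic (gradable_suspension R)
      (id_functor (gradable_category R)).
Proof.
move=> axa /eqP aa sigma_id; apply: aa.
have lin : linear (fun x : R^c^o => (a * (x : R)) : R^c^o).
  move=> b x y; rewrite [LHS](mulrDr a); congr (_ + _).
  exact: (@mulrA R a x b).
pose A := HB.pack_for {linear R^c^o -> R^c^o}
  (fun x : R^c^o => (a * (x : R)) : R^c^o)
  (GRing.isLinear.Build R^c R^c^o R^c^o *:%R _ lin).
have := @suspension_sign R _ _ A regular_fg regular_projective regular_fg
  regular_projective 1 sigma_id.
rewrite /A /= => /(_ _)/[!mulr1]; apply => h y.
have hE (r : R) : h r = (h 1 : R) * r :> R.
  have := linearZZ h (r : R^c) (1 : R^c^o).
  have -> : (r : R^c) *: (1 : R^c^o) = r by exact: (@mul1r R r).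
  by move=> ->.
apply: etrans (congr1 (fun z : R => a * z) (hE (a * (y : R)))) _.
have E (b z : R) : a * (b * (a * z)) = 0 by rewrite !mulrA axa mul0r.
exact: E.
Qed.

End Regular.

(** * Path algebras modulo one path *)

Section PathAlgebra.
Variables (k : fieldType) (Q : quiver).
Local Notation kQ := (path_algebra k Q).

Definition path_coeff (q : qpath Q) (x : kQ) : k := mcoeff q x.

Lemma path_coeff_linear q : scalar (path_coeff q).
Proof. by move=> c x y; rewrite /path_coeff mcoeffD mcoeffZ. Qed.
HB.instance Definition _ q := GRing.isLinear.Build k kQ k *%R
  (path_coeff q) (path_coeff_linear q).

Lemma path_coeffZ q c x : path_coeff q (c *: x) = c * path_coeff q x.
Proof. exact: mcoeffZ. Qed.

Lemma path_coeff_elt (q p : qpath Q) :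
  path_coeff q (path_elt k p) = (p == q)%:R.
Proof. by rewrite /path_coeff path_elt.unlock mcoeffU. Qed.

Lemma size_path_comp (p q r : qpath Q) : path_comp p q = Some r ->
  size (val r).2 = (size (val q).2 + size (val p).2)%N.
Proof.
case: (eqVneq (path_tgt q) (path_src p)) => [e|/path_compN -> //].
by case: (path_compE e) => r' -> E [<-]; rewrite E size_cat.
Qed.

(** The ideal generated by a path is spanned by the paths through it, and these
are at least as long. *)
Lemma path_coeff_ideal (q p : qpath Q) (x : kQ) :
  (size (val q).2 < size (val p).2)%N ->
  x \in two_sided_ideal (path_elt k p) -> path_coeff q x = 0.
Proof.
move=> lt_qp /asboolP[s ->]; rewrite raddf_sum /= big1 // => -[y z] _ /=.
elim/palg_ind: y z => [|c u y IHy] z; first by rewrite !mul0r raddf0.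
rewrite !mulrDl raddfD /= IHy addr0.
rewrite -[X in X * z]/(palg_mul (c *: path_elt k u) (path_elt k p)).
rewrite palg_mulZl palg_mulUU /path_mul.
case up: (path_comp u p) => [v|]; last by rewrite scaler0 mul0r raddf0.
rewrite -[_ * z]/(palg_mul (c *: path_elt k v) z) palg_mulZl path_coeffZ.
apply/eqP; rewrite mulf_eq0; apply/orP; right; apply/eqP.
elim/palg_ind: z => [|d w z IHz]; first by rewrite palg_mul0r raddf0.
rewrite palg_mulDr palg_mulZr raddfD /= IHz addr0 path_coeffZ palg_mulUU.
rewrite /path_mul.
case vw: (path_comp v w) => [r|]; last by rewrite raddf0 mulr0.
rewrite path_coeff_elt; case: eqP => [rq|_]; last exact: mulr0.
move: lt_qp; rewrite -rq (size_path_comp vw) (size_path_comp up).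
by rewrite addnCA ltnNge leq_addr.
Qed.

Lemma path_elt_sandwich (p : qpath Q) (x : kQ) :
  (forall r : qpath Q, path_src r = path_tgt p -> path_tgt r != path_src p) ->
  path_elt k p * x * path_elt k p = 0.
Proof.
move=> no_return.
elim/palg_ind: x => [|c r x IH]; first by rewrite mulr0 mul0r.
rewrite mulrDr mulrDl IH addr0.
rewrite -[X in X * _]/(palg_mul (path_elt k p) (c *: path_elt k r)).
rewrite palg_mulZr palg_mulUU /path_mul.
case pr: (path_comp p r) => [u|]; last by rewrite scaler0 mul0r.
rewrite -[LHS]/(palg_mul (c *: path_elt k u) (path_elt k p)).
rewrite palg_mulZl palg_mulUU /path_mul path_compN ?scaler0 //.
rewrite (path_comp_src pr).
have rp : path_tgt r = path_src p.
  by apply/eqP; apply: contra_eqT pr => /path_compN ->.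
apply: contraTneq isT => e.
by have := no_return r (esym e); rewrite rp eqxx.
Qed.

End PathAlgebra.

Lemma quot_proj0 (R : pzRingType) (r : R) : quot_proj r 0 = 0.
Proof. by apply: (addrI (quot_proj r 0)); rewrite -quot_projD !addr0. Qed.

(** * The triangle *)

Theorem mainTheorem3 (k : fieldType) (hk : 2%N \notin [pchar k]) :
  ~ naturally_isomorphic (gradable_suspension (Lambda k))
      (id_functor (gradable_category (Lambda k))).
Proof.
apply: (@suspension_not_identity (Lambda k)
  (quot_proj (arrow_elt k beta * arrow_elt k alpha) (arrow_elt k alpha))).
  move=> x; rewrite -[x]quot_projK -[LHS]/(quot_mul (quot_mul _ _) _).
  rewrite -!quot_projM path_elt_sandwich ?quot_proj0 //.
  (* A path from [v2] stays at [v2] or ends at the target of an arrow, and no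
     arrow has target [v1]. *)
  move=> [[v s] w]; rewrite /path_src /path_tgt /endpoint /= => ->.
  case/lastP: s w => [_|s a _]; apply/eqP; rewrite ?map_rcons ?last_rcons //.
  by case: a.
rewrite -quot_projD -quot_proj0; apply/eqP => /quot_projP; rewrite subr0.
have [p <- hp] : exists2 p, path_elt k p = arrow_elt k beta * arrow_elt k alpha
    & size (val p).2 = 2%N.
  have [p pE hp] := @path_compE triangle (arrow_path (beta : arr triangle))
    (arrow_path (alpha : arr triangle)) erefl.
  exists p; last by rewrite hp.
  by rewrite -[RHS]/(palg_mul _ _) palg_mulUU /path_mul pE.
move=> /(path_coeff_ideal (q := arrow_path (alpha : arr triangle))).
rewrite hp raddfD /= path_coeff_elt eqxx => /(_ isT) /eqP two0.
by move: hk; rewrite inE /= (natrD k 1 1) two0.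
Qed.
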